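(* For every $x\in\mathbb{C}\setminus(\mathbb{Z}\setminus\{0\})$ and every $t\in[0,1)$, \[ {}_3F_2\left({1,1,3/2\atop 2-x,2+x};1-t\right)=\frac{2(1-x^2)}{1-t}\sum_{n=1}^\infty\left(\frac{\sqrt t-1}{\sqrt t+1}\right)^n\left(\frac1{x-n}-\frac1{x+n}\right). \]
   Context: For $x\in\mathbb{C}$ and integer $n\ge0$, $(x)_n:=x(x+1)\cdots(x+n-1)$ with $(x)_0:=1$. The generalized hypergeometric series is \[ {}_pF_q\left({a_1,\ldots,a_p\atop b_1,\ldots,b_q};z\right):=\sum_{n=0}^\infty \frac{(a_1)_n\cdots(a_p)_n}{(b_1)_n\cdots(b_q)_n}\frac{z^n}{n!}. \] *)

(* Defs.v *)
From Stdlib Require Import Reals List Factorial.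
From Coquelicot Require Import Coquelicot.
Import ListNotations.

Local Open Scope C_scope.

Fixpoint Cpoch (x : C) (n : nat) : C :=
  match n with
  | O => 1
  | S m => Cpoch x m * (x + INR m)
  end.

Definition Cprod (l : list C) : C := fold_right Cmult (RtoC 1) l.

(* Meaningful only if no element of [bs] is a nonpositive integer: [Cinv]
   is total. *)
Definition pFq_term (as_ bs : list C) (z : C) (n : nat) : C :=
  Cprod (map (fun a => Cpoch a n) as_) / Cprod (map (fun b => Cpoch b n) bs)
  * (z ^ n / INR (fact n)).

(* Coquelicot's [Series] is real-valued only. Convergence in [C] is
   componentwise, so this is the sum whenever [ex_series a]; otherwise the
   value carries no meaning. *)
Definition CSeries (a : nat -> C) : C :=
  (Series (fun n => Re (a n)), Series (fun n => Im (a n))).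

Definition pFq (as_ bs : list C) (z : C) : C := CSeries (pFq_term as_ bs z).

(* Main.v *)
Require Import Defs.
From Stdlib Require Import Reals List ZArith Lra Lia Factorial.
From Coquelicot Require Import Coquelicot.
Import ListNotations.

(* Put [u = (1 - sqrt t) / (1 + sqrt t)] and [w = (1 - t) / 4 = u / (1 + u) ^ 2].
   By partial fractions in [x], with [b_k = (-1) ^ (k - 1) * 4 k / (k ^ 2 - x ^ 2)],
   the partial sums of the hypergeometric series are, up to the factor
   [(1 - x ^ 2) / (4 w)], the finite sums [sum_(k <= M) b_k p_M(k)], where [p_M(k)]
   is the part of degree at most [M] in [w] of
   [u ^ k = sum_m (k / m) binom (2 m) (m - k) w ^ m].
   These satisfy [p_(M+1)(k) = w (p_M(k-1) + 2 p_M(k) + p_M(k+1))], hence decrease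
   in [k] and converge to [u ^ k] as [M] grows.  Since [sum b_k] converges, Abel
   summation makes the tails in [k] uniformly small in [M], so the limit can be
   taken termwise; this covers [t = 0], where the series on the right converges
   only conditionally. *)

Local Open Scope R_scope.

(** * Abel summation and limits of series under monotone weights *)

(** Summation by parts. Of the weights, only the value [s N] enters the bound, which makes it
    uniform over families of weights. *)
Lemma abel_tail_bound (b s : nat -> R) (N : nat) (e : R) :
  (forall m, (N <= m)%nat -> Rabs (sum_n b m - sum_n b N) <= e) ->
  (forall k, 0 <= s (S k) <= s k) ->
  forall m, (N <= m)%nat ->
  Rabs (sum_n (fun k => b k * s k) m - sum_n (fun k => b k * s k) N) <= e * s N.
Proof.
intros Hb Hs.
(* With the boundary term subtracted, passing from [m] to [S m] adds only [(sum_n b m - sum_n b N) *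
   (s m - s (S m))], and the bounds on these telescope. *)
assert (key : forall m, (N <= m)%nat ->
  Rabs (sum_n (fun k => b k * s k) m - sum_n (fun k => b k * s k) N
        - (sum_n b m - sum_n b N) * s m) <= e * (s N - s m)).
{ induction 1 as [|m Hm IH].
  - rewrite Rabs_right; lra.
  - rewrite !sum_Sn; change plus with Rplus.
    replace (_ - _) with
      ((sum_n (fun k => b k * s k) m - sum_n (fun k => b k * s k) N
        - (sum_n b m - sum_n b N) * s m)
       + (sum_n b m - sum_n b N) * (s m - s (S m))) by ring.
    eapply Rle_trans; [apply Rabs_triang|].
    rewrite (Rabs_mult (_ - _) (s m - s (S m))).
    rewrite (Rabs_right (s m - s (S m))) by (specialize (Hs m); lra).
    specialize (Hb m Hm); specialize (Hs m).
    assert (Rabs (sum_n b m - sum_n b N) * (s m - s (S m)) <= e * (s m - s (S m)))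
      by (apply Rmult_le_compat_r; lra).
    lra. }
intros m Hm.
replace (_ - _) with
  ((sum_n (fun k => b k * s k) m - sum_n (fun k => b k * s k) N
        - (sum_n b m - sum_n b N) * s m)
   + (sum_n b m - sum_n b N) * s m) by ring.
eapply Rle_trans; [apply Rabs_triang|].
assert (s_ge0 : 0 <= s m) by (destruct (Hs m); lra).
rewrite (Rabs_mult (_ - _) (s m)), (Rabs_right (s m)) by lra.
assert (Rabs (sum_n b m - sum_n b N) * s m <= e * s m)
  by (apply Rmult_le_compat_r; auto).
specialize (key m Hm); lra.
Qed.

Lemma ex_series_tail (b : nat -> R) (e : R) : ex_series b -> 0 < e ->
  exists N, forall n m, (N <= n)%nat -> (N <= m)%nat ->
  Rabs (sum_n b m - sum_n b n) <= e.
Proof.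
intros [l Hl] He.
assert (H : ex_finite_lim_seq (sum_n b)) by (exists l; exact Hl).
apply ex_lim_seq_cauchy_corr in H.
destruct (H (mkposreal e He)) as [N HN]; exists N; intros n m Hn Hm.
left; apply HN; assumption.
Qed.

(** Abel's test: the weights stay below [s 0], so the Cauchy criterion for [b] carries over through
    [abel_tail_bound]. *)
Lemma ex_series_abel (b s : nat -> R) :
  ex_series b -> (forall k, 0 <= s (S k) <= s k) ->
  ex_series (fun k => b k * s k).
Proof.
intros Hb Hs.
assert (H : ex_finite_lim_seq (sum_n (fun k => b k * s k))).
{ apply ex_lim_seq_cauchy_corr; intros eps.
  assert (s0 : forall k, 0 <= s k <= s 0%nat).
  { induction k as [|k IH]; specialize (Hs 0%nat) as H0; [|specialize (Hs k)]; lra. }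
  (* [s 0] may vanish, hence the denominator [s 0 + 1]. *)
  assert (He : 0 < eps / (s 0%nat + 1)).
  { apply Rdiv_lt_0_compat; [apply cond_pos|]; specialize (s0 0%nat); lra. }
  destruct (ex_series_tail b (eps / (s 0%nat + 1) / 4) Hb) as [N HN]; [lra|].
  exists N.
  assert (tl : forall m, (N <= m)%nat ->
    Rabs (sum_n (fun k => b k * s k) m - sum_n (fun k => b k * s k) N) <= eps / 4).
  { intros m Hm; eapply Rle_trans.
    - apply (abel_tail_bound b s N (eps / (s 0%nat + 1) / 4)); auto.
    - assert (eps / (s 0%nat + 1) / 4 * s N <= eps / (s 0%nat + 1) / 4 * (s 0%nat + 1)).
      { apply Rmult_le_compat_l; [|specialize (s0 N)]; lra. }
      replace (eps / 4) with (eps / (s 0%nat + 1) / 4 * (s 0%nat + 1)); [lra|].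
      field; specialize (s0 0%nat); lra. }
  intros n m Hn Hm.
  pose proof (tl n Hn) as H1; pose proof (tl m Hm) as H2.
  pose proof (cond_pos eps).
  apply Rabs_le_between in H1; apply Rabs_le_between in H2.
  apply Rabs_def1; lra. }
destruct H as [l Hl]; exists l; exact Hl.
Qed.

Lemma is_lim_seq_sum_n (f : nat -> nat -> R) (g : nat -> R) (N : nat) :
  (forall k, is_lim_seq (fun M => f M k) (g k)) ->
  is_lim_seq (fun M => sum_n (f M) N) (sum_n g N).
Proof.
intros H; induction N as [|N IH].
- rewrite sum_O; eapply is_lim_seq_ext; [|apply H].
  intros M; cbv beta; rewrite sum_O; reflexivity.
- rewrite sum_Sn; eapply is_lim_seq_ext;
    [|apply (is_lim_seq_plus' _ _ _ _ IH (H (S N)))].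
  intros M; cbv beta; rewrite sum_Sn; reflexivity.
Qed.

(** Monotonicity in [k] takes the place of a summable majorant: beyond some [N] all tails are small
    uniformly in [M], and the finite head converges termwise. The tail bound holds up to any upper
    index, so that index may move with [M]. *)
Lemma abel_dominated_convergence (b : nat -> R) (p : nat -> nat -> R) (q : nat -> R) :
  ex_series b ->
  (forall M k, 0 <= p M (S k) <= p M k) -> (forall M, p M 0%nat <= 1) ->
  (forall k, is_lim_seq (fun M => p M k) (q k)) ->
  ex_series (fun k => b k * q k) /\
  is_lim_seq (fun M => sum_n (fun k => b k * p M k) M) (Series (fun k => b k * q k)).
Proof.
intros Hb Hp Hp1 Hlim.
assert (p01 : forall M k, 0 <= p M k <= 1).
{ intros M; induction k as [|k IH]; specialize (Hp M) as H0; specialize (Hp1 M).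
  - specialize (H0 0%nat); lra.
  - specialize (H0 k); lra. }
assert (q_dec : forall k, 0 <= q (S k) <= q k).
{ intros k; split.
  - apply (is_lim_seq_le (fun _ => 0) (fun M => p M (S k)) 0 (q (S k)));
      [intros; apply p01|apply is_lim_seq_const|apply Hlim].
  - apply (is_lim_seq_le (fun M => p M (S k)) (fun M => p M k) (q (S k)) (q k));
      [intros; apply Hp|apply Hlim|apply Hlim]. }
assert (q1 : forall k, 0 <= q k <= 1).
{ intros k; split.
  - destruct (q_dec k); lra.
  - apply (is_lim_seq_le (fun M => p M k) (fun _ => 1) (q k) 1);
      [intros; apply p01|apply Hlim|apply is_lim_seq_const]. }
assert (Hq : ex_series (fun k => b k * q k)) by (apply ex_series_abel; auto).
split; [exact Hq|].
apply is_lim_seq_spec; intros eps.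
assert (He : 0 < eps / 4) by (pose proof (cond_pos eps); lra).
destruct (ex_series_tail b (eps / 4) Hb He) as [N HN].
assert (tl : forall s, (forall k, 0 <= s (S k) <= s k) -> (forall k, 0 <= s k <= 1) ->
  forall m, (N <= m)%nat ->
  Rabs (sum_n (fun k => b k * s k) m - sum_n (fun k => b k * s k) N) <= eps / 4).
{ intros s Hs s1 m Hm; eapply Rle_trans.
  - apply (abel_tail_bound b s N (eps / 4)); auto.
  - rewrite <- (Rmult_1_r (eps / 4)) at 2; apply Rmult_le_compat_l; [lra|apply s1]. }
(* The tail bound for [q] passes to the limit in the upper index. *)
assert (tlq : Rabs (Series (fun k => b k * q k) - sum_n (fun k => b k * q k) N) <= eps / 4).
{ apply (is_lim_seq_le_loc
    (fun m => Rabs (sum_n (fun k => b k * q k) m - sum_n (fun k => b k * q k) N))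
    (fun _ => eps / 4) (Rabs (Series (fun k => b k * q k) - sum_n (fun k => b k * q k) N))
    (eps / 4)).
  - exists N; intros m Hm; apply tl; auto.
  - apply (is_lim_seq_abs _ (Finite _)).
    apply is_lim_seq_minus'; [apply (Series_correct _ Hq)|apply is_lim_seq_const].
  - apply is_lim_seq_const. }
assert (Hfin : is_lim_seq (fun M => sum_n (fun k => b k * p M k) N)
                 (sum_n (fun k => b k * q k) N)).
{ apply (is_lim_seq_sum_n (fun M k => b k * p M k) (fun k => b k * q k)); intros k.
  apply (is_lim_seq_scal_l _ _ (Finite _)), Hlim. }
apply is_lim_seq_spec in Hfin; destruct (Hfin (mkposreal _ He)) as [N' HN']; simpl in HN'.
exists (max N N'); intros M HM.
specialize (HN' M ltac:(lia)).
pose proof (tl (p M) (Hp M) (p01 M) M ltac:(lia)) as H1.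
apply Rabs_def2 in HN'; apply Rabs_le_between in H1; apply Rabs_le_between in tlq.
apply Rabs_def1; lra.
Qed.

(** * Truncated first passage generating functions and their limit *)

(* Generating function, truncated at [w ^ M], of the first passage times at [k]
   of the walk with steps of weights [w], [2 w], [w]. *)
Fixpoint passage (w : R) (M k : nat) : R :=
  match M, k with
  | _, O => 1
  | O, S _ => 0
  | S M', S k' =>
      w * (passage w M' k' + 2 * passage w M' (S k') + passage w M' (S (S k')))
  end.

Lemma passage_0 (w : R) (M : nat) : passage w M 0 = 1.
Proof. destruct M; reflexivity. Qed.

Lemma passage_S (w : R) (M k : nat) : passage w (S M) (S k) =
  w * (passage w M k + 2 * passage w M (S k) + passage w M (S (S k))).
Proof. reflexivity. Qed.

Lemma passage_eq0 (w : R) (M k : nat) : (M < k)%nat -> passage w M k = 0.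
Proof.
revert k; induction M as [|M IH]; intros [|k] Hk; try lia; [reflexivity|].
rewrite passage_S, !IH by lia; ring.
Qed.

Lemma passage_ge0 (w : R) (M k : nat) : 0 <= w -> 0 <= passage w M k.
Proof.
intros Hw; revert k; induction M as [|M IH]; intros [|k];
  try (rewrite ?passage_0; simpl; lra).
rewrite passage_S; apply Rmult_le_pos; [exact Hw|].
pose proof (IH k); pose proof (IH (S k)); pose proof (IH (S (S k))); lra.
Qed.

Lemma passage_incr (w : R) (M k : nat) : 0 <= w -> passage w M k <= passage w (S M) k.
Proof.
intros Hw; revert k; induction M as [|M IH]; intros [|k];
  try (rewrite !passage_0; lra).
- apply (passage_ge0 w 1 (S k) Hw).
- rewrite (passage_S w M), (passage_S w (S M)); apply Rmult_le_compat_l; [exact Hw|].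
  pose proof (IH k); pose proof (IH (S k)); pose proof (IH (S (S k))); lra.
Qed.

(** The hypothesis on [u] and [w] makes [u ^ k] a fixed point of the recurrence, which is monotone;
    the comparison at [M = 0] therefore propagates. *)
Lemma passage_le_pow (u w : R) (M k : nat) :
  0 <= u -> 0 <= w -> w * (1 + u) ^ 2 = u -> passage w M k <= u ^ k.
Proof.
intros Hu Hw Huw; revert k; induction M as [|M IH]; intros [|k];
  try (rewrite ?passage_0; simpl; lra).
- apply pow_le, Hu.
- rewrite passage_S.
  replace (u ^ S k) with (w * (u ^ k + 2 * u ^ S k + u ^ S (S k))).
  + apply Rmult_le_compat_l; [exact Hw|].
    pose proof (IH k); pose proof (IH (S k)); pose proof (IH (S (S k))); lra.
  + simpl; transitivity (w * (1 + u) ^ 2 * u ^ k); [ring|rewrite Huw; ring].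
Qed.

(** The recurrence preserves decrease in [k]; at the boundary [k = 0] the bound by [u <= 1] is used
    instead. *)
Lemma passage_decr (u w : R) (M k : nat) :
  0 <= u <= 1 -> 0 <= w -> w * (1 + u) ^ 2 = u -> passage w M (S k) <= passage w M k.
Proof.
intros Hu Hw Huw; revert k; induction M as [|M IH]; intros [|k];
  try (simpl; lra).
- rewrite (passage_0 w (S M)); eapply Rle_trans; [apply (passage_le_pow u); tauto|].
  simpl; lra.
- rewrite (passage_S w M (S k)), (passage_S w M k); apply Rmult_le_compat_l; [exact Hw|].
  pose proof (IH k); pose proof (IH (S k)); pose proof (IH (S (S k))); lra.
Qed.

(** The increments never fall below the first one, [e 1], so [e] grows at least linearly unless
    [e 1 = 0]; boundedness forces the latter. *)
Lemma bounded_convex_seq_eq0 (e : nat -> R) (c : R) :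
  0 <= c -> e 0%nat = 0 -> (forall k, 0 <= e k <= 1) ->
  (forall k, e (S (S k)) = (2 + c) * e (S k) - e k) ->
  forall k, e k = 0.
Proof.
intros Hc He0 Hb Hrec.
assert (step : forall k, e 1%nat <= e (S k) - e k).
{ induction k as [|k IH]; [lra|].
  rewrite Hrec; pose proof (Hb (S k)); nra. }
assert (lin : forall k, INR k * e 1%nat <= e k).
{ induction k as [|k IH]; [simpl; lra|].
  rewrite S_INR; specialize (step k); lra. }
assert (He1 : e 1%nat = 0).
{ apply Rle_antisym; [|apply Hb]; apply Rnot_lt_le; intros Hpos.
  destruct (INR_archimed (e 1%nat) 1 Hpos) as [n Hn].
  specialize (lin n); specialize (Hb n); lra. }
assert (both : forall k, e k = 0 /\ e (S k) = 0).
{ induction k as [|k [IH1 IH2]]; [auto|].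
  split; [exact IH2|rewrite Hrec, IH1, IH2; ring]. }
intros k; apply both.
Qed.

(** The limit [q] exists by monotonicity in [M] and satisfies the same recurrence as [u ^ k], with
    the same value at [0]. Their difference is bounded, hence zero; the argument includes
    [w = 1 / 4], where the characteristic root [1] is double. *)
Lemma passage_lim (u w : R) (k : nat) :
  0 <= u <= 1 -> 0 < w <= 1 / 4 -> w * (1 + u) ^ 2 = u ->
  is_lim_seq (fun M => passage w M k) (u ^ k).
Proof.
intros Hu Hw Huw.
assert (ex : forall j, ex_finite_lim_seq (fun M => passage w M j)).
{ intros j; apply (ex_finite_lim_seq_incr _ (u ^ j)); intros M.
  - apply passage_incr; lra.
  - apply passage_le_pow; lra. }
assert (cv : forall j, is_lim_seq (fun M => passage w M j)
                         (real (Lim_seq (fun M => passage w M j)))).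
{ intros j; apply Lim_seq_correct', ex. }
set (q := fun j => real (Lim_seq (fun M => passage w M j))) in *.
assert (q0 : q 0%nat = 1).
{ unfold q; rewrite (Lim_seq_ext _ (fun _ => 1)) by apply passage_0.
  rewrite Lim_seq_const; reflexivity. }
assert (qrec : forall j, q (S j) = w * (q j + 2 * q (S j) + q (S (S j)))).
{ intros j.
  assert (H : is_lim_seq (fun M => passage w (S M) (S j))
                (w * (q j + 2 * q (S j) + q (S (S j))))).
  { apply (is_lim_seq_scal_l _ w (Finite _)).
    apply is_lim_seq_plus'; [apply is_lim_seq_plus'|]; try apply cv.
    apply (is_lim_seq_scal_l _ 2 (Finite _)), cv. }
  apply (is_lim_seq_incr_1 (fun M => passage w M (S j))) in H.
  apply is_lim_seq_unique in H; unfold q at 1; rewrite H; reflexivity. }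
assert (qb : forall j, 0 <= q j <= u ^ j).
{ intros j; split.
  - apply (is_lim_seq_le (fun _ => 0) (fun M => passage w M j) 0 (q j));
      [intros; apply passage_ge0; lra|apply is_lim_seq_const|apply cv].
  - apply (is_lim_seq_le (fun M => passage w M j) (fun _ => u ^ j) (q j) (u ^ j));
      [intros; apply passage_le_pow; lra|apply cv|apply is_lim_seq_const]. }
assert (E : forall j, u ^ j - q j = 0).
(* Divided by [w], the recurrence has middle coefficient [/ w - 2 = 2 + c], and [w <= 1 / 4] gives
   [c >= 0]. *)
{ apply (bounded_convex_seq_eq0 _ (/ w - 4)).
  - assert (4 <= / w); [|lra].
    replace 4 with (/ (1 / 4)) by field; apply Rinv_le_contravar; lra.
  - rewrite q0; simpl; ring.
  - intros j; specialize (qb j).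
    assert (u ^ j <= 1); [|lra].
    rewrite <- (pow1 j); apply pow_incr; lra.
  - intros j.
    assert (Hq : q (S (S j)) = (/ w - 2) * q (S j) - q j).
    { apply (Rmult_eq_reg_l w); [|lra].
      replace (w * ((/ w - 2) * q (S j) - q j))
        with (q (S j) - 2 * w * q (S j) - w * q j) by (field; lra).
      specialize (qrec j); lra. }
    assert (Hp : u ^ S (S j) = (/ w - 2) * u ^ S j - u ^ j).
    { apply (Rmult_eq_reg_l w); [|lra].
      replace (w * ((/ w - 2) * u ^ S j - u ^ j))
        with (u ^ S j - 2 * w * u ^ S j - w * u ^ j) by (field; lra).
      simpl; transitivity ((w * (1 + u) ^ 2 - 2 * w * u - w) * u ^ j);
        [ring|rewrite Huw; ring]. }
    rewrite Hq, Hp; ring. }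
replace (u ^ k) with (q k) by (specialize (E k); lra).
apply cv.
Qed.

(** * Ballot numbers and their recurrences *)

(* The coefficient of [w ^ S n] in the first passage generating function at [k],
   i.e. [(k / m) * binom (2 m) (m - k)] for [m = S n]. *)
Definition ballot (n k : nat) : R :=
  if (k <=? S n)%nat then
    2 * INR k * INR (fact (2 * n + 1)) / (INR (fact (S n - k)) * INR (fact (S n + k)))
  else 0.

Lemma ballot_eq0 (n k : nat) : (S n < k)%nat -> ballot n k = 0.
Proof.
intros H; unfold ballot; rewrite (proj2 (Nat.leb_gt _ _)) by lia; reflexivity.
Qed.

Lemma ballot_0 (n : nat) : ballot n 0 = 0.
Proof. unfold ballot; simpl; unfold Rdiv; ring. Qed.

(** Writing [S n = k + j] removes the truncated subtraction and the test, leaving a form that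
    [field] can treat. *)
Lemma ballot_fact (n k j : nat) : S n = (k + j)%nat ->
  ballot n k = 2 * INR k * INR (fact (2 * n + 1)) / (INR (fact j) * INR (fact (2 * k + j))).
Proof.
intros H; unfold ballot; rewrite (proj2 (Nat.leb_le _ _)) by lia.
replace (S n - k)%nat with j by lia; replace (S n + k)%nat with (2 * k + j)%nat by lia.
reflexivity.
Qed.

Lemma INR_fact_S (n : nat) : INR (fact (S n)) = (INR n + 1) * INR (fact n).
Proof. rewrite fact_simpl, mult_INR, S_INR; reflexivity. Qed.

(** Quotient of the factorial formulas for [n + 1] and [n]. For [k = n + 2], where only
    [ballot (S n) k] is nonzero, the factor on the left vanishes. *)
Lemma ballot_step (n k : nat) :
  ((INR n + 2) ^ 2 - INR k ^ 2) * ballot (S n) k =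
  2 * (INR n + 1) * (2 * INR n + 3) * ballot n k.
Proof.
destruct (le_lt_dec k (S n)) as [Hk|Hk].
- destruct (Nat.le_exists_sub _ _ Hk) as [j [Hj _]].
  rewrite (ballot_fact n k j), (ballot_fact (S n) k (S j)) by lia.
  replace (2 * S n + 1)%nat with (S (S (2 * n + 1))) by lia.
  replace (2 * k + S j)%nat with (S (2 * k + j)) by lia.
  rewrite !INR_fact_S, !S_INR.
  assert (Hn : INR n = INR j + INR k - 1).
  { rewrite <- plus_INR, <- Hj, S_INR; ring. }
  rewrite !plus_INR, !mult_INR, Hn; simpl (INR 2); simpl (INR 1).
  pose proof (pos_INR j); pose proof (pos_INR k).
  field; repeat split; try apply INR_fact_neq_0; lra.
- rewrite (ballot_eq0 n k Hk), Rmult_0_r.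
  destruct (Nat.eq_dec k (S (S n))) as [->|Hk'].
  + rewrite !S_INR; ring.
  + rewrite ballot_eq0 by lia; ring.
Qed.

(** Coefficient form of the recurrence of [passage]. The cases are: all terms in the support, the
    last one outside, only the first one inside, none inside. *)
Lemma ballot_rec (n k : nat) :
  ballot (S n) (S k) = ballot n k + 2 * ballot n (S k) + ballot n (S (S k)).
Proof.
destruct (le_lt_dec (S (S k)) (S n)) as [Hk|Hk];
  [|destruct (Nat.eq_dec (S k) (S n)) as [Hk'|Hk'];
    [|destruct (Nat.eq_dec k (S n)) as [->|Hk'']]].
- destruct (Nat.le_exists_sub _ _ Hk) as [j [Hj _]].
  rewrite (ballot_fact n (S (S k)) j), (ballot_fact n (S k) (S j)),
    (ballot_fact n k (S (S j))), (ballot_fact (S n) (S k) (S (S j))) by lia.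
  replace (2 * S n + 1)%nat with (S (S (2 * n + 1))) by lia.
  replace (2 * S (S k) + j)%nat with (S (S (2 * k + S (S j)))) by lia.
  replace (2 * S k + S (S j))%nat with (S (S (2 * k + S (S j)))) by lia.
  replace (2 * S k + S j)%nat with (S (2 * k + S (S j))) by lia.
  rewrite !INR_fact_S.
  assert (Hn : INR n = INR j + INR k + 1).
  { replace n with (j + k + 1)%nat by lia; rewrite !plus_INR; simpl (INR 1); ring. }
  rewrite !S_INR, !plus_INR, !mult_INR, !S_INR, Hn; simpl (INR 0).
  pose proof (pos_INR j); pose proof (pos_INR k).
  field; repeat split; try apply INR_fact_neq_0; lra.
- replace n with k by lia.
  rewrite (ballot_eq0 k (S (S k))) by lia.
  rewrite (ballot_fact k (S k) 0), (ballot_fact k k 1),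
    (ballot_fact (S k) (S k) 1) by lia.
  replace (2 * S k + 1)%nat with (S (S (2 * k + 1))) by lia.
  replace (2 * S k + 0)%nat with (S (2 * k + 1)) by lia.
  rewrite !INR_fact_S.
  rewrite !S_INR, !plus_INR, !mult_INR; simpl (INR 0); simpl (INR 1); simpl (INR 2);
  simpl (fact 0); simpl (fact 1); simpl (INR 1).
  pose proof (pos_INR k).
  field; repeat split; try apply INR_fact_neq_0; lra.
- rewrite (ballot_eq0 n (S (S n))), (ballot_eq0 n (S (S (S n)))) by lia.
  rewrite (ballot_fact n (S n) 0), (ballot_fact (S n) (S (S n)) 0) by lia.
  replace (2 * S n + 1)%nat with (S (S (2 * n + 1))) by lia.
  replace (2 * S n + 0)%nat with (S (2 * n + 1)) by lia.
  replace (2 * S (S n) + 0)%nat with (S (S (S (2 * n + 1)))) by lia.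
  rewrite !INR_fact_S.
  rewrite !S_INR, !plus_INR, !mult_INR; simpl (INR 0); simpl (INR 1); simpl (INR 2);
  simpl (fact 0); simpl (INR 1).
  pose proof (pos_INR n).
  field; repeat split; try apply INR_fact_neq_0; lra.
- rewrite !ballot_eq0 by lia; ring.
Qed.

(** Both sides obey the same recurrence in [M]; this identifies [passage w M k], for [k > 0], as a
    partial sum of the power series with coefficients [ballot]. *)
Lemma passage_diff (w : R) (M k : nat) :
  passage w (S M) k = passage w M k + ballot M k * w ^ S M.
Proof.
revert k; induction M as [|M IH]; intros [|k];
  try (rewrite !passage_0, ballot_0; ring).
- rewrite passage_S; destruct k as [|k].
  + rewrite (ballot_fact 0 1 0) by reflexivity; simpl; field.
  + rewrite ballot_eq0 by lia; simpl; ring.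
- rewrite (passage_S w M k), (passage_S w (S M) k), !IH, ballot_rec; simpl; ring.
Qed.

(* [a_k = (-1) ^ k * k] satisfies [a_(k-1) + 2 a_k + a_(k+1) = 0], so inserting
   [ballot_rec] makes the sum telescope. *)
Lemma alternating_moment_ballot (n : nat) :
  sum_n (fun k => (-1) ^ k * INR (S k) * ballot (S n) (S k)) (S n) = 0.
Proof.
assert (T : forall N, sum_n (fun k => (-1) ^ k * INR (S k) * ballot (S n) (S k)) N =
  (-1) ^ N * (INR N + 1) * ballot n (S (S N)) + (-1) ^ N * (INR N + 2) * ballot n (S N)).
{ induction N as [|N IH].
  - rewrite sum_O, ballot_rec, ballot_0; simpl; ring.
  - rewrite sum_Sn; change plus with Rplus; rewrite IH, ballot_rec, !S_INR; simpl; ring. }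
(* At [N = S n] both remaining terms lie beyond the support [k <= S n] of [ballot n]. *)
rewrite T, !ballot_eq0 by lia; rewrite !Rmult_0_r; apply Rplus_0_r.
Qed.

(** * Complex series by components, and the partial fractions in [x] *)

Local Open Scope C_scope.

Lemma sum_n_C (a : nat -> C) (n : nat) :
  sum_n a n = (sum_n (fun k => Re (a k)) n, sum_n (fun k => Im (a k)) n).
Proof.
induction n as [|n IH].
- rewrite !sum_O; apply surjective_pairing.
- rewrite !sum_Sn, IH; reflexivity.
Qed.

Lemma is_series_C (a : nat -> C) (l1 l2 : R) :
  is_series (fun n => Re (a n)) l1 -> is_series (fun n => Im (a n)) l2 ->
  is_series a (l1, l2).
Proof.
intros H1 H2; unfold is_series in *.
apply (filterlim_ext (fun n => (sum_n (fun k => Re (a k)) n, sum_n (fun k => Im (a k)) n))).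
- intros n; symmetry; apply sum_n_C.
- intros P [eps HP].
  destruct (H1 _ (locally_ball l1 eps)) as [N1 HN1].
  destruct (H2 _ (locally_ball l2 eps)) as [N2 HN2].
  exists (max N1 N2); intros n Hn; apply HP; split; [apply HN1|apply HN2]; lia.
Qed.

Lemma CSeries_unique (a : nat -> C) (l1 l2 : R) :
  is_series (fun n => Re (a n)) l1 -> is_series (fun n => Im (a n)) l2 ->
  CSeries a = (l1, l2).
Proof.
intros H1 H2; unfold CSeries; f_equal; apply is_series_unique; assumption.
Qed.

Lemma sub_add_INR_neq0 (x : C) (k : nat) :
  (forall j : Z, j <> 0%Z -> x <> RtoC (IZR j)) -> (0 < k)%nat ->
  x - INR k <> 0 /\ x + INR k <> 0 /\ RtoC (INR k) ^ 2 - x ^ 2 <> 0.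
Proof.
intros hx Hk.
assert (H1 : x - INR k <> 0).
{ intros E; apply (hx (Z.of_nat k)); [lia|].
  rewrite <- INR_IZR_INZ; rewrite <- (Cplus_0_r (RtoC (INR k))), <- E; ring. }
assert (H2 : x + INR k <> 0).
{ intros E; apply (hx (- Z.of_nat k)%Z); [lia|].
  rewrite opp_IZR, <- INR_IZR_INZ, RtoC_opp.
  rewrite <- (Cplus_0_r (- RtoC (INR k))), <- E; ring. }
repeat split; try assumption.
replace (RtoC (INR k) ^ 2 - x ^ 2) with (- ((x - INR k) * (x + INR k))) by ring.
intros E; apply (Cmult_neq_0 _ _ H1 H2).
transitivity (- - ((x - INR k) * (x + INR k))); [ring|rewrite E; ring].
Qed.

(* The [k]-th coefficient, counted from [0], of the expansion in powers of
   [u = (1 - sqrt t) / (1 + sqrt t)]. *)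
Definition pole_coef (x : C) (k : nat) : C :=
  4 * (-1) ^ k * INR (S k) / (RtoC (INR (S k)) ^ 2 - x ^ 2).

(** The coefficient of [w ^ S n] in the sum of [pole_coef x k * u ^ S k] re-expanded in [w]; it is a
    finite sum because [ballot n (S k)] vanishes for [k > n]. *)
Definition ballot_sum (x : C) (n : nat) : C :=
  sum_n (fun k => pole_coef x k * ballot n (S k)) n.

Lemma ballot_sum_0 (x : C) : ballot_sum x 0 = 4 / (1 - x ^ 2).
Proof.
unfold ballot_sum; rewrite sum_O, (ballot_fact 0 1 0) by reflexivity; unfold pole_coef.
simpl (INR _); replace (2 * 1 * 1 / (1 * (1 + 1)))%R with 1%R by field.
unfold Cdiv; replace (RtoC 1 ^ 2) with (RtoC 1) by ring; ring.
Qed.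

(** Split [(n + 2) ^ 2 - x ^ 2] as [((n + 2) ^ 2 - k ^ 2) + (k ^ 2 - x ^ 2)] at the pole [k]: the
    first part is [ballot_step], the second cancels the denominator and leaves the alternating
    moment, which is zero. *)
Lemma ballot_sum_S (x : C) (n : nat) :
  (forall j : Z, j <> 0%Z -> x <> RtoC (IZR j)) ->
  (RtoC (INR n + 2) ^ 2 - x ^ 2) * ballot_sum x (S n) =
  RtoC (2 * (INR n + 1) * (2 * INR n + 3)) * ballot_sum x n.
Proof.
intros hx; unfold ballot_sum.
assert (T : forall N,
  (RtoC (INR n + 2) ^ 2 - x ^ 2) *
    sum_n (fun k => pole_coef x k * ballot (S n) (S k)) N =
  RtoC (2 * (INR n + 1) * (2 * INR n + 3)) *
    sum_n (fun k => pole_coef x k * ballot n (S k)) N +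
  4 * RtoC (sum_n (fun k => (-1) ^ k * INR (S k) * ballot (S n) (S k))%R N)).
{ assert (term : forall k,
    (RtoC (INR n + 2) ^ 2 - x ^ 2) * (pole_coef x k * ballot (S n) (S k)) =
    RtoC (2 * (INR n + 1) * (2 * INR n + 3)) * (pole_coef x k * ballot n (S k)) +
    4 * RtoC ((-1) ^ k * INR (S k) * ballot (S n) (S k))).
  { intros k.
    destruct (sub_add_INR_neq0 x (S k) hx ltac:(lia)) as [_ [_ Hk]].
    transitivity (pole_coef x k *
        RtoC (((INR n + 2) ^ 2 - INR (S k) ^ 2) * ballot (S n) (S k)) +
      pole_coef x k * (RtoC (INR (S k)) ^ 2 - x ^ 2) * ballot (S n) (S k)).
    - rewrite RtoC_mult, RtoC_minus, !RtoC_pow; ring.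
    - rewrite ballot_step; unfold pole_coef.
      rewrite !RtoC_mult, RtoC_pow.
      field; exact Hk. }
  induction N as [|N IH].
  - rewrite !sum_O; apply term.
  - rewrite !sum_Sn.
    change (@plus C_AbelianMonoid) with Cplus.
    change (@plus R_AbelianMonoid) with Rplus.
    rewrite Cmult_plus_distr_l, IH, term, RtoC_plus.
    ring. }
rewrite T, alternating_moment_ballot, sum_Sn, (ballot_eq0 n (S (S n))) by lia.
change (@plus C_AbelianMonoid) with Cplus.
ring.
Qed.

Lemma RtoC_neq0 (r : R) : r <> 0%R -> RtoC r <> 0.
Proof. intros Hr E; apply Hr, RtoC_inj, E. Qed.

(** Stated for an arbitrary sequence [T] because on the hypergeometric side the summands of [T n]
    themselves depend on [n]. *)
Lemma CSeries_scal_lim (a T : nat -> C) (c : C) (l1 l2 : R) :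
  (forall n, sum_n a n = c * T n) ->
  is_lim_seq (fun n => Re (T n)) l1 -> is_lim_seq (fun n => Im (T n)) l2 ->
  ex_series a /\ CSeries a = c * (l1, l2).
Proof.
intros Ha H1 H2.
assert (HR : is_series (fun n => Re (a n)) (Re (c * (l1, l2)))).
{ change (is_lim_seq (sum_n (fun n => Re (a n))) (Re c * l1 - Im c * l2)%R).
  apply (is_lim_seq_ext (fun n => Re c * Re (T n) - Im c * Im (T n))%R).
  - intros n; transitivity (Re (sum_n a n)); [|rewrite sum_n_C; reflexivity].
    rewrite Ha; reflexivity.
  - apply is_lim_seq_minus'; apply (is_lim_seq_scal_l _ _ (Finite _)); assumption. }
assert (HI : is_series (fun n => Im (a n)) (Im (c * (l1, l2)))).
{ change (is_lim_seq (sum_n (fun n => Im (a n))) (Re c * l2 + Im c * l1)%R).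
  apply (is_lim_seq_ext (fun n => Re c * Im (T n) + Im c * Re (T n))%R).
  - intros n; transitivity (Im (sum_n a n)); [|rewrite sum_n_C; reflexivity].
    rewrite Ha; reflexivity.
  - apply is_lim_seq_plus'; apply (is_lim_seq_scal_l _ _ (Finite _)); assumption. }
split.
- eexists; apply is_series_C; eassumption.
- rewrite (CSeries_unique _ _ _ HR HI); symmetry; apply surjective_pairing.
Qed.

(** * Convergence of the series of pole coefficients *)

Lemma ex_series_inv_consecutive :
  ex_series (fun k => / ((INR k + 1) * (INR k + 2)))%R.
Proof.
exists 1%R.
change (is_lim_seq (sum_n (fun k => / ((INR k + 1) * (INR k + 2)))%R) 1%R).
apply (is_lim_seq_ext (fun n => 1 - / (INR n + 2))%R).
- induction n as [|n IH].
  + rewrite sum_O; simpl; field.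
  + rewrite sum_Sn, <- IH; change plus with Rplus; rewrite S_INR.
    pose proof (pos_INR n); field; lra.
- replace 1%R with (1 - 0)%R at 1 by ring.
  apply is_lim_seq_minus'; [apply is_lim_seq_const|].
  apply (is_lim_seq_inv _ p_infty); [|discriminate].
  apply (is_lim_seq_plus _ _ p_infty 2%R p_infty);
    [apply is_lim_seq_INR|apply is_lim_seq_const|reflexivity].
Qed.

Lemma ex_series_alternating_harmonic :
  ex_series (fun k => (-1) ^ k * / (INR k + 1))%R.
Proof.
apply ex_series_Reals_1, (alternated_series (fun k => / (INR k + 1))%R).
- intros k; rewrite S_INR; pose proof (pos_INR k); apply Rinv_le_contravar; lra.
- apply is_lim_seq_Reals, (is_lim_seq_inv _ p_infty); [|discriminate].
  apply (is_lim_seq_plus _ _ p_infty 1%R p_infty);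
    [apply is_lim_seq_INR|apply is_lim_seq_const|reflexivity].
Qed.

(** What remains of [pole_coef] after its leading part [4 * (-1) ^ k / (k + 1)]; it is of order
    [k ^ (-3)]. *)
Definition pole_rem (x : C) (k : nat) : C :=
  4 * (-1) ^ k * x ^ 2 / (INR (S k) * (RtoC (INR (S k)) ^ 2 - x ^ 2)).

Lemma pole_coefE (x : C) (k : nat) :
  (forall j : Z, j <> 0%Z -> x <> RtoC (IZR j)) ->
  pole_coef x k = RtoC (4 * ((-1) ^ k * / (INR k + 1))) + pole_rem x k.
Proof.
intros hx; destruct (sub_add_INR_neq0 x (S k) hx ltac:(lia)) as [_ [_ Hk]].
assert (Hk1 : RtoC (INR (S k)) <> 0) by (apply RtoC_neq0, not_0_INR; lia).
unfold pole_coef, pole_rem; rewrite <- S_INR, !RtoC_mult, RtoC_inv, RtoC_pow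
  by (apply not_0_INR; lia).
field; auto.
Qed.

Lemma ex_series_Cmod_pole_rem (x : C) :
  (forall j : Z, j <> 0%Z -> x <> RtoC (IZR j)) ->
  ex_series (fun k => Cmod (pole_rem x k)).
Proof.
intros hx.
set (r := Cmod (x ^ 2)).
assert (Hr : (0 <= r)%R) by apply Cmod_ge_0.
(* From [N] on, [n = k + 1] satisfies [2 * r <= n <= n ^ 2], so [n ^ 2 - x ^ 2] has modulus at least
   [n ^ 2 / 2]. *)
destruct (INR_archimed 1 (2 * r) Rlt_0_1) as [N HN].
apply (ex_series_incr_n _ N).
apply (ex_series_le (K := R_AbsRing) (V := R_CompleteNormedModule) _
  (fun k => 16 * r * / ((INR (N + k) + 1) * (INR (N + k) + 2)))%R).
- intros j; set (k := (N + j)%nat); change norm with Rabs.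
  rewrite Rabs_right by (apply Rle_ge, Cmod_ge_0).
  destruct (sub_add_INR_neq0 x (S k) hx ltac:(lia)) as [_ [_ Hk]].
  assert (HkN : (INR N <= INR k)%R) by (apply le_INR; lia).
  pose proof (pos_INR k) as Hk0; pose proof (pos_INR N) as HN0.
  assert (Hk1 : RtoC (INR (S k)) <> 0) by (apply RtoC_neq0, not_0_INR; lia).
  unfold pole_rem; rewrite Cmod_div by (apply Cmult_neq_0; assumption).
  rewrite !Cmod_mult, Cmod_pow, !Cmod_R; fold r.
  replace (Rabs (-1)) with 1%R by (rewrite Rabs_left; lra).
  rewrite pow1, (Rabs_right 4), (Rabs_right (INR (S k))), S_INR
    by (rewrite ?S_INR; lra).
  set (n := (INR k + 1)%R) in *.
  assert (Hn : (1 <= n)%R) by (unfold n; lra).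
  assert (Hd : (n ^ 2 / 2 <= Cmod (RtoC n ^ 2 - x ^ 2))%R).
  { assert (Cmod (RtoC n ^ 2) <= Cmod (RtoC n ^ 2 - x ^ 2) + r)%R.
    { replace (RtoC n ^ 2) with ((RtoC n ^ 2 - x ^ 2) + x ^ 2) at 1 by ring.
      apply Cmod_triangle. }
    rewrite Cmod_pow, Cmod_R, (Rabs_right n) in H by lra.
    assert (2 * r <= n)%R by (unfold n; lra).
    nra. }
  replace (INR k + 2)%R with (n + 1)%R by (unfold n; ring).
  set (d := Cmod (RtoC n ^ 2 - x ^ 2)) in *.
  apply Rle_trans with (4 * 1 * r * / (n * (n ^ 2 / 2)))%R.
  + unfold Rdiv; apply Rmult_le_compat_l; [lra|].
    apply Rinv_le_contravar; [nra|].
    apply Rmult_le_compat_l; [lra|exact Hd].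
  + replace (4 * 1 * r * / (n * (n ^ 2 / 2)))%R with (16 * r * / (2 * n ^ 3))%R
      by (field; lra).
    apply Rmult_le_compat_l; [lra|].
    apply Rinv_le_contravar; nra.
- apply (ex_series_scal_l (16 * r)%R (fun k => / ((INR (N + k) + 1) * (INR (N + k) + 2)))%R).
  apply (ex_series_incr_n (fun k => / ((INR k + 1) * (INR k + 2)))%R N),
    ex_series_inv_consecutive.
Qed.

(** An alternating harmonic series plus an absolutely convergent one; the former is real, so the
    imaginary part comes from [pole_rem] alone. *)
Lemma ex_series_pole_coef (x : C) :
  (forall j : Z, j <> 0%Z -> x <> RtoC (IZR j)) ->
  ex_series (fun k => Re (pole_coef x k)) /\ ex_series (fun k => Im (pole_coef x k)).
Proof.
intros hx.
pose proof (ex_series_Cmod_pole_rem x hx) as Hrem.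
split.
- apply (ex_series_ext (fun k => 4 * ((-1) ^ k * / (INR k + 1)) + Re (pole_rem x k))%R).
  + intros k; rewrite pole_coefE by exact hx; reflexivity.
  + apply (ex_series_plus (fun k => 4 * ((-1) ^ k * / (INR k + 1)))%R
             (fun k => Re (pole_rem x k))).
    * apply (ex_series_scal_l 4%R (fun k => (-1) ^ k * / (INR k + 1))%R),
        ex_series_alternating_harmonic.
    * apply (ex_series_le (K := R_AbsRing) (V := R_CompleteNormedModule) _ _
               (fun k => re_le_Cmod (pole_rem x k)) Hrem).
- apply (ex_series_ext (fun k => Im (pole_rem x k))).
  + intros k; rewrite pole_coefE by exact hx; simpl; ring.
  + apply (ex_series_le (K := R_AbsRing) (V := R_CompleteNormedModule) _
             (fun k => Cmod (pole_rem x k))); [|exact Hrem].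
    intros k; eapply Rle_trans; [apply Rmax_r|apply Rmax_Cmod].
Qed.

(** * Partial sums of the hypergeometric series, and the identity *)

Lemma Cpoch_neq0 (a : C) (n : nat) :
  (forall m : nat, a + INR m <> 0) -> Cpoch a n <> 0.
Proof.
intros Ha; induction n as [|n IH]; simpl.
- apply RtoC_neq0, R1_neq_R0.
- apply Cmult_neq_0; auto.
Qed.

(** Both sides agree at [n = 0] and have the same ratio of consecutive terms, by [ballot_sum_S] on
    the right. *)
Lemma pFq_term_ballot (x : C) (w : R) (n : nat) :
  (forall j : Z, j <> 0%Z -> x <> RtoC (IZR j)) -> w <> 0%R ->
  pFq_term [RtoC 1; RtoC 1; RtoC (3 / 2)] [2 - x; 2 + x] (RtoC (4 * w)) n =
  (1 - x ^ 2) / RtoC (4 * w) * (ballot_sum x n * RtoC (w ^ S n)).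
Proof.
intros hx Hw.
assert (Hw' : RtoC w <> 0) by (apply RtoC_neq0; exact Hw).
assert (H4 : RtoC 4 <> 0) by (apply RtoC_neq0; lra).
assert (Hx1 : 1 - x ^ 2 <> 0).
{ destruct (sub_add_INR_neq0 x 1 hx ltac:(lia)) as [_ [_ H]]; intros E; apply H.
  rewrite <- E; simpl (INR 1); ring. }
assert (Hm : forall m : nat, 2 - x + INR m <> 0).
{ intros m; destruct (sub_add_INR_neq0 x (2 + m) hx ltac:(lia)) as [H _].
  intros E; apply H; rewrite plus_INR, RtoC_plus; simpl (INR 2).
  replace (1 + 1)%R with 2%R by ring.
  transitivity (- (2 - x + INR m)); [ring|rewrite E; ring]. }
assert (Hp : forall m : nat, 2 + x + INR m <> 0).
{ intros m; destruct (sub_add_INR_neq0 x (2 + m) hx ltac:(lia)) as [_ [H _]].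
  intros E; apply H; rewrite plus_INR, RtoC_plus; simpl (INR 2).
  replace (1 + 1)%R with 2%R by ring.
  rewrite <- E; ring. }
induction n as [|n IH].
- unfold pFq_term; rewrite ballot_sum_0; simpl; rewrite !RtoC_mult; field.
  split; [intros E; apply Hx1; rewrite <- E; ring|exact Hw'].
- assert (Hf : RtoC (INR (fact n)) <> 0) by (apply RtoC_neq0, INR_fact_neq_0).
  assert (Hn1 : RtoC (INR n) + 1 <> 0).
  { rewrite <- RtoC_plus; apply RtoC_neq0; pose proof (pos_INR n); lra. }
  pose proof (Cpoch_neq0 _ n Hm) as Hcm; pose proof (Cpoch_neq0 _ n Hp) as Hcp.
  pose proof (ballot_sum_S x n hx) as HS.
  specialize (Hm n); specialize (Hp n).
  assert (HD : (RtoC (INR n + 2) ^ 2 - x ^ 2) = (2 - x + INR n) * (2 + x + INR n)).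
  { rewrite RtoC_plus; ring. }
  assert (HS' : ballot_sum x (S n) =
    RtoC (2 * (INR n + 1) * (2 * INR n + 3)) * ballot_sum x n /
    ((2 - x + INR n) * (2 + x + INR n))).
  { rewrite <- HS, HD; field; auto. }
  (* In this ratio one of the two factors [n + 1] from the upper parameters [1] has cancelled
     against the factorial. *)
  transitivity (pFq_term [RtoC 1; RtoC 1; RtoC (3 / 2)] [2 - x; 2 + x] (RtoC (4 * w)) n *
    ((RtoC (INR n) + 1) * (RtoC (INR n) + RtoC (3 / 2)) * RtoC (4 * w) /
     ((2 - x + INR n) * (2 + x + INR n)))).
  + unfold pFq_term, Cprod; cbn [map fold_right Cpoch Cpow].
    rewrite INR_fact_S, (RtoC_mult (INR n + 1)), RtoC_plus.
    field; repeat split; auto.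
  + rewrite IH, HS'; cbn [pow]; rewrite !RtoC_mult, !RtoC_plus, !RtoC_mult, RtoC_div by lra.
    field; repeat split; auto.
Qed.

(* [sum_n] types its results in the carrier of an abelian monoid, which [ring]
   does not recognize as [C]. *)
Local Ltac Cring := match goal with |- @eq _ ?a ?b => change (@eq C a b); ring end.

(** By [passage_diff], raising the truncation order by one adds exactly the next hypergeometric
    term. *)
Lemma sum_pFq_term (x : C) (w : R) (n : nat) :
  (forall j : Z, j <> 0%Z -> x <> RtoC (IZR j)) -> w <> 0%R ->
  sum_n (pFq_term [RtoC 1; RtoC 1; RtoC (3 / 2)] [2 - x; 2 + x] (RtoC (4 * w))) n =
  (1 - x ^ 2) / RtoC (4 * w) *
    sum_n (fun k => pole_coef x k * RtoC (passage w (S n) (S k))) n.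
Proof.
intros hx Hw.
assert (split : forall M N,
  sum_n (fun k => pole_coef x k * RtoC (passage w (S M) (S k))) N =
  sum_n (fun k => pole_coef x k * RtoC (passage w M (S k))) N +
  sum_n (fun k => pole_coef x k * ballot M (S k)) N * RtoC (w ^ S M)).
{ intros M N; induction N as [|N IH].
  - rewrite !sum_O, passage_diff, RtoC_plus, RtoC_mult; Cring.
  - rewrite !sum_Sn, IH; change (@plus C_AbelianMonoid) with Cplus.
    rewrite (passage_diff w M), RtoC_plus, RtoC_mult; Cring. }
induction n as [|n IH].
- rewrite split, !sum_O, pFq_term_ballot by assumption.
  unfold ballot_sum; rewrite sum_O, (passage_eq0 w 0 1) by lia; Cring.
- rewrite sum_Sn, IH, (split (S n)), pFq_term_ballot by assumption; fold (ballot_sum x (S n)).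
  rewrite (sum_Sn (fun k => pole_coef x k * RtoC (passage w (S n) (S k)))).
  (* The upper index can grow along with the order because the new summand is still zero at the old
     order. *)
  rewrite (passage_eq0 w (S n) (S (S n))) by lia.
  change (@plus C_AbelianMonoid) with Cplus; Cring.
Qed.

Theorem theorem2p3 (x : C) (t : R)
  (hx : forall k : Z, k <> 0%Z -> x <> RtoC (IZR k))
  (ht : (0 <= t < 1)%R) :
  let lhs_as := [RtoC 1; RtoC 1; RtoC (3 / 2)] in
  let lhs_bs := [2 - x; 2 + x] in
  let rhs_term := fun n : nat =>
    RtoC ((sqrt t - 1) / (sqrt t + 1)) ^ n * (1 / (x - INR n) - 1 / (x + INR n)) in
  ex_series (pFq_term lhs_as lhs_bs (RtoC (1 - t))) /\
  ex_series (fun n : nat => rhs_term (S n)) /\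
  pFq lhs_as lhs_bs (RtoC (1 - t)) =
    2 * (1 - x ^ 2) / RtoC (1 - t) * CSeries (fun n : nat => rhs_term (S n)).
Proof.
intros lhs_as lhs_bs rhs_term.
set (s := sqrt t) in *.
assert (Hs0 : (0 <= s)%R) by apply sqrt_pos.
assert (Hss : (s * s = t)%R) by (apply sqrt_sqrt; lra).
assert (Hs1 : (s < 1)%R) by nra.
set (u := ((1 - s) / (1 + s))%R).
set (w := ((1 - t) / 4)%R).
assert (Hu : (0 <= u <= 1)%R).
{ unfold u; split.
  - apply Rmult_le_pos; [lra|left; apply Rinv_0_lt_compat; lra].
  - apply (Rmult_le_reg_r (1 + s)); [lra|].
    replace ((1 - s) / (1 + s) * (1 + s))%R with (1 - s)%R by (field; lra); lra. }
assert (Hw : (0 < w <= 1 / 4)%R) by (unfold w; lra).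
assert (Huw : (w * (1 + u) ^ 2 = u)%R).
{ unfold w, u; rewrite <- Hss; field; lra. }
assert (Hz : (1 - t = 4 * w)%R) by (unfold w; field).
destruct (ex_series_pole_coef x hx) as [HRe HIm].
assert (Hdec : forall M k, (0 <= passage w (S M) (S (S k)) <= passage w (S M) (S k))%R).
{ intros M k; split; [apply passage_ge0|apply (passage_decr u)]; lra. }
assert (Hle1 : forall M, (passage w (S M) 1 <= 1)%R).
{ intros M; eapply Rle_trans; [apply (passage_le_pow u w); lra|simpl; lra]. }
assert (Hlim : forall k, is_lim_seq (fun M => passage w (S M) (S k)) (u ^ S k)%R).
{ intros k; apply (is_lim_seq_incr_1 (fun M => passage w M (S k))).
  apply passage_lim; lra. }
destruct (abel_dominated_convergence _ (fun M k => passage w (S M) (S k))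
  (fun k => u ^ S k)%R HRe Hdec Hle1 Hlim) as [ExRe LimRe].
destruct (abel_dominated_convergence _ (fun M k => passage w (S M) (S k))
  (fun k => u ^ S k)%R HIm Hdec Hle1 Hlim) as [ExIm LimIm].
(* [L1] and [L2] are the components of the limit that both sides share up to constant factors. *)
set (L1 := Series (fun k => Re (pole_coef x k) * u ^ S k)%R) in *.
set (L2 := Series (fun k => Im (pole_coef x k) * u ^ S k)%R) in *.
assert (ReM : forall (c : C) (r : R), Re (c * RtoC r) = (Re c * r)%R)
  by (intros [a b] r; unfold Re, Im; simpl; ring).
assert (ImM : forall (c : C) (r : R), Im (c * RtoC r) = (Im c * r)%R)
  by (intros [a b] r; unfold Re, Im; simpl; ring).
destruct (CSeries_scal_lim (pFq_term lhs_as lhs_bs (RtoC (1 - t)))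
  (fun n => sum_n (fun k => pole_coef x k * RtoC (passage w (S n) (S k))) n)
  ((1 - x ^ 2) / RtoC (1 - t)) L1 L2) as [Ex1 Val1].
{ intros n; rewrite Hz; apply sum_pFq_term; [exact hx|lra]. }
{ eapply is_lim_seq_ext; [|exact LimRe]; intros n; cbv beta.
  rewrite sum_n_C; apply sum_n_ext; intros k; symmetry; apply ReM. }
{ eapply is_lim_seq_ext; [|exact LimIm]; intros n; cbv beta.
  rewrite sum_n_C; apply sum_n_ext; intros k; symmetry; apply ImM. }
destruct (CSeries_scal_lim (fun n => rhs_term (S n))
  (sum_n (fun k => pole_coef x k * RtoC (u ^ S k))) (/ 2) L1 L2) as [Ex2 Val2].
(* With [n = S k], the bracket is [- 2 n / (n ^ 2 - x ^ 2)] and the base of the power is [- u]; the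
   signs combine to [(-1) ^ k], and [2] against the [4] of [pole_coef] gives [/ 2]. *)
{ assert (term : forall k, rhs_term (S k) = / 2 * (pole_coef x k * RtoC (u ^ S k))).
  { intros k; unfold rhs_term, pole_coef.
    destruct (sub_add_INR_neq0 x (S k) hx ltac:(lia)) as [H1 [H2 H3]].
    replace ((s - 1) / (s + 1))%R with (-1 * u)%R by (unfold u; field; lra).
    rewrite <- RtoC_pow, Rpow_mult_distr, RtoC_mult, (RtoC_pow (-1)).
    cbn [Cpow].
    field; repeat split; auto.
    intros E; apply H3; rewrite <- E; ring. }
  induction n as [|n IH].
  - rewrite !sum_O; apply term.
  - rewrite !sum_Sn, IH, term; change (@plus C_AbelianMonoid) with Cplus; Cring. }
{ eapply is_lim_seq_ext; [|exact (Series_correct _ ExRe)]; intros n; cbv beta.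
  rewrite sum_n_C; apply sum_n_ext; intros k; symmetry; apply ReM. }
{ eapply is_lim_seq_ext; [|exact (Series_correct _ ExIm)]; intros n; cbv beta.
  rewrite sum_n_C; apply sum_n_ext; intros k; symmetry; apply ImM. }
split; [exact Ex1|split; [exact Ex2|]].
unfold pFq; rewrite Val1, Val2; field.
apply RtoC_neq0; lra.
Qed.
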